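(* Let $n,m$ be positive integers, $\lambda=(1^n)$ and $\mu=(m)$. Then in $\mathbb{Z}\mathfrak{S}_{n+m}$, $$Y_{\mathfrak{t}^\lambda}Y_{(\mathfrak{t}^\mu)^{+n}}Y_{\mathfrak{t}^\lambda\oslash\mathfrak{t}^\mu}=\sum_{\rho\in\mathfrak{S}_n\mathfrak{S}_m^{+n}}m!\,n!\,\mathrm{sgn}(\sigma_\rho)\,\rho+\sum_{a=1}^n\sum_{b=1}^m\sum_{\rho\in C_{a,b}}m!\,(n-1)!\,\mathrm{sgn}(h_\rho)\,\rho.$$ In particular, $\theta_{(1^n),(m)}=m!\,(n-1)!$, where $\theta_{(1^n),(m)}$ is the greatest common divisor of the coefficients of $Y_{\mathfrak{t}^\lambda}Y_{(\mathfrak{t}^\mu)^{+n}}Y_{\mathfrak{t}^\lambda\oslash\mathfrak{t}^\mu}$.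
   Context: Permutations are composed from right to left. For a set $S$ of permutations, $\{S\}=\sum_{\sigma\in S}\sigma$ and $[S]=\sum_{\sigma\in S}\mathrm{sgn}(\sigma)\sigma$. $\mathfrak{S}_X$ for $X\subseteq\{1,\dots,n+m\}$ is viewed as a subgroup of $\mathfrak{S}_{n+m}$ (fixing points outside $X$); $\mathfrak{S}_n=\mathfrak{S}_{\{1,\dots,n\}}$ and $\mathfrak{S}_m^{+n}=\mathfrak{S}_{\{n+1,\dots,n+m\}}$; for $\tau\in\mathfrak{S}_m$, $\tau^{+n}\in\mathfrak{S}_m^{+n}$ is given by $\tau^{+n}(x+n)=\tau(x)+n$. For integers $a\le b$, write $[a,b]$ for the integer interval $\{a,\dots,b\}$. For a tableau $\mathfrak{s}$ with row stabilizer $R_{\mathfrak{s}}$ and column stabilizer $C_{\mathfrak{s}}$, the Young symmetrizer is $Y_{\mathfrak{s}}=\{R_{\mathfrak{s}}\}[C_{\mathfrak{s}}]$. Here $\mathfrak{t}^\lambda$ is the one-column tableau with entries $1,\dots,n$ from top to bottom, $(\mathfrak{t}^\mu)^{+n}$ is the one-row tableau with entries $n+1,\dots,n+m$, and $\mathfrak{t}^\lambda\oslash\mathfrak{t}^\mu$ is the tableau of shape $(m+1,1^{n-1})$ with first column entries $1,\dots,n$ from top to bottom and first row entries $1,n+1,\dots,n+m$ from left to right. Thus $Y_{\mathfrak{t}^\lambda}=[\mathfrak{S}_n]$, $Y_{(\mathfrak{t}^\mu)^{+n}}=\{\mathfrak{S}_m^{+n}\}$ and $Y_{\mathfrak{t}^\lambda\oslash\mathfrak{t}^\mu}=\{\mathfrak{S}_{\{1\}\cup[n+1,n+m]}\}[\mathfrak{S}_n]$.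 For $\rho\in\mathfrak{S}_n\mathfrak{S}_m^{+n}$, $\sigma_\rho\in\mathfrak{S}_n$ and $\tau_\rho\in\mathfrak{S}_m$ are the unique elements with $\rho=\sigma_\rho\tau_\rho^{+n}$. For $a\in[1,n]$, $b\in[1,m]$, $$C_{a,b}=\{\rho\in\mathfrak{S}_{n+m}\mid\rho([1,n]\setminus\{a\})\subseteq[1,n],\ \rho(a)=n+b\}.$$ For $i,b\in[1,m]$ and $a\in[1,n]$ let $\alpha_a=(1,a)$, $\beta_b=(n+i,n+b)$ (which depends on $i$), $\gamma_i=(1,n+i)$, where $(1,1)$ and $(n+i,n+i)$ are read as the identity. For $\rho\in C_{a,b}$, let $a'$ be the unique element of $[1,n]$ not in $\rho([1,n])$; then for each $i\in[1,m]$ there are unique $h\in\mathfrak{S}_{[2,n]}$ and $\tau\in\mathfrak{S}_m$ with $\rho=\alpha_{a'}\beta_b\gamma_i\tau^{+n}h\alpha_a$, and $h$ does not depend on $i$; this $h$ is denoted $h_\rho$.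
   Formalization: In the second sum the coefficient sgn(h_ρ), wrong as printed (for n=2, m=1 the 3-cycles have coefficient −1, but h_ρ=1), is replaced by sgn(α_{a'})·sgn(h_ρ)·sgn(α_a); everything else is unchanged. *)

(* Defs.v *)
From HB Require Import structures.
From mathcomp Require Import all_boot all_order all_algebra all_fingroup.

Set Implicit Arguments.
Unset Strict Implicit.
Unset Printing Implicit Defensive.

Import GRing.Theory.
Local Open Scope ring_scope.

(* Permutations are composed from right to left, whereas [s * t]%g of MathComp
   means "first s, then t". *)
Definition pcomp (T : finType) (s t : {perm T}) : {perm T} := (t * s)%g.

Notation "s \oP t" := (pcomp s t) (at level 50, left associativity).

Lemma pcompE (T : finType) (s t : {perm T}) x : (s \oP t) x = s (t x).
Proof. by rewrite /pcomp permM. Qed.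

Lemma pcompA (T : finType) : associative (@pcomp T).
Proof. by move=> s t u; rewrite /pcomp mulgA. Qed.

(* sgn(s) as an integer. *)
Definition psgn (T : finType) (s : {perm T}) : int := (-1) ^+ (odd_perm s).

(* The integral group ring of the symmetric group on T: an element is the
   function giving its coefficients. *)
Definition zperm (T : finType) : Type := {ffun {perm T} -> int}.

HB.instance Definition _ (T : finType) := GRing.Zmodule.on (zperm T).

Section GroupRing.
Variable T : finType.
Implicit Types u v w : zperm T.

Definition zcoef u (s : {perm T}) : int := (u : {ffun {perm T} -> int}) s.

Definition zdelta (s : {perm T}) : zperm T := [ffun r => (r == s)%:R : int].

Definition zmul u v : zperm T :=
  [ffun r => \sum_s \sum_(t | s \oP t == r) zcoef u s * zcoef v t].

Lemma zpermP u v : (forall s, zcoef u s = zcoef v s) -> u = v.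
Proof. by move=> eq_uv; apply/ffunP=> s; apply: eq_uv. Qed.

Lemma zcoefD u v s : zcoef (u + v) s = zcoef u s + zcoef v s.
Proof. by rewrite /zcoef ffunE. Qed.

Lemma zcoef_delta r s : zcoef (zdelta s) r = (r == s)%:R.
Proof. by rewrite /zcoef ffunE. Qed.

Lemma zcoefM u v r :
  zcoef (zmul u v) r = \sum_s zcoef u s * zcoef v ((r * s^-1)%g).
Proof.
rewrite /zcoef ffunE; apply: eq_bigr => s _.
rewrite (big_pred1 (r * s^-1)%g) // => t /=.
by rewrite /pcomp -(can_eq (mulgK s^-1%g)) mulgK.
Qed.

Fact zmulA : associative zmul.
Proof.
move=> u v w; apply: zpermP => r; rewrite !zcoefM.
under eq_bigr => s _ do rewrite zcoefM mulr_sumr.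
under [RHS]eq_bigr => s _ do rewrite zcoefM mulr_suml.
rewrite [RHS]exchange_big /=; apply: eq_bigr => s _.
rewrite [RHS](reindex_inj (mulIg s)) /=; apply: eq_bigr => t _.
by rewrite mulgK mulrA invMg mulgA.
Qed.

Fact zmul1l : left_id (zdelta 1) zmul.
Proof.
move=> u; apply: zpermP => r; rewrite zcoefM (bigD1 1%g) //= big1.
  by rewrite zcoef_delta eqxx mul1r invg1 mulg1 addr0.
by move=> s /negPf ns1; rewrite zcoef_delta ns1 mul0r.
Qed.

Fact zmul1r : right_id (zdelta 1) zmul.
Proof.
move=> u; apply: zpermP => r; rewrite zcoefM (bigD1 r) //= big1.
  by rewrite mulgV zcoef_delta eqxx mulr1 addr0.
move=> s /negPf nsr; rewrite zcoef_delta -(inj_eq (mulIg s)) mulgKV mul1g.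
by rewrite eq_sym nsr mulr0.
Qed.

Fact zmulDl : left_distributive zmul +%R.
Proof.
move=> u v w; apply: zpermP => r; rewrite zcoefD !zcoefM -big_split /=.
by apply: eq_bigr => s _; rewrite zcoefD mulrDl.
Qed.

Fact zmulDr : right_distributive zmul +%R.
Proof.
move=> u v w; apply: zpermP => r; rewrite zcoefD !zcoefM -big_split /=.
by apply: eq_bigr => s _; rewrite zcoefD mulrDr.
Qed.

Fact zoner_neq0 : zdelta 1 != 0.
Proof.
apply/eqP => /(congr1 (fun u : zperm T => zcoef u 1%g)) /eqP.
by rewrite zcoef_delta eqxx /zcoef ffunE.
Qed.

End GroupRing.

HB.instance Definition _ (T : finType) :=
  GRing.Zmodule_isNzRing.Build (zperm T)
    (@zmulA T) (@zmul1l T) (@zmul1r T) (@zmulDl T) (@zmulDr T) (@zoner_neq0 T).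

(* {S} and [S] *)
Definition zsum (T : finType) (S : {set {perm T}}) : zperm T :=
  \sum_(s in S) zdelta s.

Definition zaltsum (T : finType) (S : {set {perm T}}) : zperm T :=
  \sum_(s in S) zdelta s *~ psgn s.

Definition coef_gcd (T : finType) (u : zperm T) : nat :=
  \big[gcdn/0%N]_(s : {perm T}) `|zcoef u s|%N.

(* A tableau (with distinct entries in T) is given by the list of its rows,
   from top to bottom, each listed from left to right. *)
Definition tableau (T : Type) := seq (seq T).

Definition tab_map (T U : Type) (f : T -> U) (t : tableau T) : tableau U :=
  [seq [seq f x | x <- r] | r <- t].

(* The top row is the longest one, so its length is the number of columns. *)
Definition tab_cols (T : Type) (t : tableau T) : seq (seq T) :=
  [seq pmap (fun r => onth r j) t | j <- iota 0 (size (head [::] t))].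

(* Permutations preserving each of the given blocks and fixing every point that
   lies in none of them; thus a tableau with entries in a part of T yields
   subgroups of the symmetric group on T. *)
Definition block_stab (T : finType) (bs : seq (seq T)) : {set {perm T}} :=
  [set s : {perm T} | perm_on [set x in flatten bs] s
                      & all (fun b => all (fun x => s x \in b) b) bs].

Definition row_stab (T : finType) (t : tableau T) := block_stab t.
Definition col_stab (T : finType) (t : tableau T) := block_stab (tab_cols t).

Definition young (T : finType) (t : tableau T) : zperm T :=
  zsum (row_stab t) * zaltsum (col_stab t).

(* {1, ..., n+m} is 'I_(n + m) with indices shifted down by one: a in [1,n] is
   [lshift m a] for a : 'I_n, and n+b with b in [1,m] is [rshift n b] for
   b : 'I_m. *)

Definition tab_col (n : nat) : tableau 'I_n := [seq [:: i] | i <- enum 'I_n].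

Definition tab_row (m : nat) : tableau 'I_m := [:: enum 'I_m].

Definition tab_left (n m : nat) : tableau 'I_(n + m) :=
  tab_map (lshift m) (tab_col n).

Definition tab_right (n m : nat) : tableau 'I_(n + m) :=
  tab_map (@rshift n m) (tab_row m).

Definition tab_hook (n m : nat) : tableau 'I_(n + m) :=
  [seq lshift m i ::
       (if i == 0 :> nat then [seq rshift n j | j <- enum 'I_m] else [::])
  | i <- enum 'I_n].

Definition young_prod (n m : nat) : zperm 'I_(n + m) :=
  young (tab_left n m) * young (tab_right n m) * young (tab_hook n m).

Definition theta (n m : nat) : nat := coef_gcd (young_prod n m).

Definition int_1n (n m : nat) : {set 'I_(n + m)} := [set x : 'I_(n + m) | (x < n)%N].
Definition int_2n (n m : nat) : {set 'I_(n + m)} := [set x : 'I_(n + m) | (0 < x < n)%N].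
Definition int_n1nm (n m : nat) : {set 'I_(n + m)} := [set x : 'I_(n + m) | (n <= x)%N].

Definition SnSm (n m : nat) : {set 'S_(n + m)} :=
  [set s \oP t | s in Sym (int_1n n m), t in Sym (int_n1nm n m)].

Definition pshift_fun (n m : nat) (t : 'S_m) (x : 'I_(n + m)) : 'I_(n + m) :=
  match split x with inl i => lshift m i | inr j => rshift n (t j) end.

Lemma pshift_inj n m (t : 'S_m) : injective (@pshift_fun n m t).
Proof.
apply: (can_inj (g := pshift_fun (t^-1)%g)) => x.
rewrite -[x in RHS]splitK /pshift_fun.
by case: (split x) => [i|j] /=; [rewrite (unsplitK (inl i))
  | rewrite (unsplitK (inr (t j))) permK].
Qed.

(* t^{+n} *)
Definition pshift (n m : nat) (t : 'S_m) : 'S_(n + m) :=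
  perm (@pshift_inj n m t).

(* The default values 1 below (and a in [miss]) are never used: sigma_of is
   applied to rho in SnSm n m only, miss and h_of to rho in Cset a b only, and
   there the picked element exists and is unique. *)
Definition sigma_of (n m : nat) (rho : 'S_(n + m)) : 'S_(n + m) :=
  odflt 1%g [pick s in Sym (int_1n n m) |
    [exists t : 'S_m, rho == s \oP pshift n t]].

Definition Cset (n m : nat) (a : 'I_n) (b : 'I_m) : {set 'S_(n + m)} :=
  [set rho : 'S_(n + m) |
    [forall x : 'I_n, (x != a) ==> (rho (lshift m x) < n)%N]
    && (rho (lshift m a) == rshift n b)].

Section Decomposition.
Variables (n m : nat) (n_gt0 : (0 < n)%N).

Definition pt1 : 'I_(n + m) := lshift m (Ordinal n_gt0).

Definition alpha (a : 'I_n) : 'S_(n + m) := tperm pt1 (lshift m a).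
Definition beta (i b : 'I_m) : 'S_(n + m) := tperm (rshift n i) (rshift n b).
Definition gamma (i : 'I_m) : 'S_(n + m) := tperm pt1 (rshift n i).

(* a', the element of [1,n] not in rho([1,n]) *)
Definition miss (a : 'I_n) (rho : 'S_(n + m)) : 'I_n :=
  odflt a [pick y : 'I_n | lshift m y \notin rho @: int_1n n m].

Definition h_of (a : 'I_n) (b : 'I_m) (rho : 'S_(n + m)) : 'S_(n + m) :=
  odflt 1%g [pick h in Sym (int_2n n m) |
    [forall i : 'I_m, exists t : 'S_m,
      rho == alpha (miss a rho) \oP beta i b \oP gamma i
             \oP pshift n t \oP h \oP alpha a]].

(* The coefficient of rho in C_{a,b} must change sign when rho is multiplied on
   either side by a transposition of S_n.  Since h only records part of rho, the
   sign with this property is sgn(alpha_{a'}) sgn(h) sgn(alpha_a); sgn(h) alone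
   fails already for n = 2, where h is always 1. *)
Definition sgnC (a : 'I_n) (b : 'I_m) (rho : 'S_(n + m)) : int :=
  psgn (alpha (miss a rho)) * psgn (h_of a b rho) * psgn (alpha a).

End Decomposition.

(* Main.v *)
Require Import Defs.
From mathcomp Require Import all_boot all_order all_algebra all_fingroup.

Set Implicit Arguments.
Unset Strict Implicit.
Unset Printing Implicit Defensive.

Import GRing.Theory.
Local Open Scope ring_scope.

(** Let X = {1} union [n+1,n+m]. The product is [S_n]{S_m}{S_X}[S_n], and it
    equals m! [S_n]{S_X}[S_n] since S_m is a subgroup of S_X. Writing
    rho = s g s' with s, s' in S_n and g in S_X, the permutation t = s s' agrees
    with rho on [1,n] except possibly at a = s'^-1(1); conversely, any t in S_n
    agreeing with rho off a arises from the (n-1)! choices of s' with s'(a) = 1.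
    So the coefficient of rho is m! (n-1)! times the sum over a of sgn(t), where
    t in S_n agrees with rho on [1,n] minus a; such a t is unique if it exists.
    It exists for every a if rho is in S_n S_m, for exactly one a if rho is in
    some C_{a,b}, and for no a otherwise. *)

(** * Coefficients in the group ring, and stabilizers with one large block *)

Section GroupRingCoefficients.
Variable T : finType.
Implicit Types (u v : zperm T) (r s : {perm T}).

Lemma zcoef0 s : zcoef (0 : zperm T) s = 0.
Proof. by rewrite /zcoef ffunE. Qed.

Lemma zcoef_sum I (l : seq I) (P : pred I) (F : I -> zperm T) s :
  zcoef (\sum_(i <- l | P i) F i) s = \sum_(i <- l | P i) zcoef (F i) s.
Proof.
apply: (big_morph (fun u => zcoef u s)); last exact: zcoef0.
by move=> u v; apply: zcoefD.
Qed.

Lemma zcoefN u s : zcoef (- u) s = - zcoef u s.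
Proof. by apply/eqP; rewrite -addr_eq0 -zcoefD addNr zcoef0. Qed.

Lemma zcoefMz u (k : int) s : zcoef (u *~ k) s = k * zcoef u s.
Proof.
have zcoefMn j : zcoef (u *+ j) s = j%:Z * zcoef u s.
  elim: j => [|j IHj]; first by rewrite zcoef0 mul0r.
  by rewrite mulrS zcoefD IHj intS mulrDl mul1r.
by case: k => j; rewrite ?NegzE ?mulrNz ?zcoefN ?zcoefMn ?mulNr.
Qed.

Lemma zcoef_combination (A : {set {perm T}}) (c : {perm T} -> int) r :
  zcoef (\sum_(s in A) zdelta s *~ c s) r = if r \in A then c r else 0.
Proof.
rewrite zcoef_sum; under eq_bigr => s _ do rewrite zcoefMz zcoef_delta.
case: ifP => rA.
  rewrite (bigD1 r) //= eqxx mulr1 big1 ?addr0 // => s /andP[_ /negPf].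
  by rewrite eq_sym => ->; rewrite mulr0.
apply: big1 => s sA; case: eqP => [e|_]; last by rewrite mulr0.
by rewrite e sA in rA.
Qed.

Lemma zcoef_zsum A r : zcoef (zsum A) r = (r \in A)%:R :> int.
Proof.
have := zcoef_combination A (fun=> 1) r.
by rewrite /zsum; under eq_bigr do rewrite mulr1z; move=> ->; case: (r \in A).
Qed.

Lemma zcoef_zaltsum A r : zcoef (zaltsum A) r = (r \in A)%:R * psgn r.
Proof. by rewrite zcoef_combination; case: ifP; rewrite ?mul1r ?mul0r. Qed.

Lemma zsum1 : zsum [set 1%g] = 1 :> zperm T.
Proof. by rewrite /zsum big_set1. Qed.

Lemma psgn1 : psgn (1%g : {perm T}) = 1.
Proof. by rewrite /psgn odd_perm1. Qed.

Lemma psgnM s r : psgn (s * r)%g = psgn s * psgn r.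
Proof. by rewrite /psgn odd_permM signr_addb. Qed.

Lemma zaltsum1 : zaltsum [set 1%g] = 1 :> zperm T.
Proof. by rewrite /zaltsum big_set1 psgn1 mulr1z. Qed.

(** For [s] in [H], [r * s^-1] lies in [G] exactly when [r] does, so every [s] in [H] contributes
    equally to the coefficient of [r]. *)
Lemma zsum_sub_mul (H G : {group {perm T}}) :
  H \subset G -> zsum H * zsum G = zsum G *~ #|H|%:Z.
Proof.
move=> sHG; apply: zpermP => r; rewrite zcoefM zcoefMz zcoef_zsum.
under eq_bigr => s _ do rewrite !zcoef_zsum.
rewrite -[_%:Z]natz -sum1_card natr_sum mulr_suml [RHS]big_mkcond /=.
apply: eq_bigr => s _; case: ifP => sH; rewrite ?mul0r ?mul1r //.
by rewrite groupMr // groupV (subsetP sHG).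
Qed.

Lemma Sym0 : Sym (set0 : {set T}) = [set 1%g].
Proof.
apply/setP=> s; rewrite !inE; apply/idP/eqP => [s0 | ->]; last exact: perm_on1.
by apply: perm_on_id s0 _; rewrite cards0.
Qed.

(** The three tableaux are hooks, with at most one row and one column of length above 1, so this
    computes all six stabilizers; [b = [::]] covers the case of singleton blocks only. *)
Lemma block_stab_singletons (b : seq T) (bs : seq (seq T)) :
    {subset b <= flatten bs} ->
    (forall c, c \in bs -> c = b \/ exists2 x, c = [:: x] & x \notin b) ->
  block_stab bs = Sym [set x in b].
Proof.
move=> b_bs bsP; apply/setP=> s; rewrite !inE; apply/andP/idP.
  case=> s_on /allP s_bs; apply/subsetP=> x; rewrite !inE => sx.
  have /flattenP[c c_bs xc] : x \in flatten bs.
    by apply: contraR sx => xbs; rewrite (out_perm s_on) // inE.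
  have /allP/(_ x xc) := s_bs c c_bs.
  case: (bsP c c_bs) => [e|[y ec _]]; first by rewrite -e.
  move: xc sx; rewrite ec !inE => /eqP-> sx.
  by rewrite (negPf sx).
move=> s_on; split.
  by apply: subset_trans s_on _; apply/subsetP=> x; rewrite !inE; apply: b_bs.
apply/allP=> c /bsP[->|[x -> xb]].
  by apply/allP=> x xb; have := perm_closed x s_on; rewrite !inE xb.
by rewrite /= (out_perm s_on) ?inE ?eqxx ?xb.
Qed.

End GroupRingCoefficients.

Lemma enum_ord_head n (n_gt0 : (0 < n)%N) :
  exists2 e, enum 'I_n = Ordinal n_gt0 :: e
           & all (fun i : 'I_n => i != 0 :> nat) e.
Proof.
case: n n_gt0 => // n n_gt0; rewrite enum_ordSl.
exists [seq lift ord0 i | i <- enum 'I_n]; first by congr cons; apply: val_inj.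
by rewrite all_map; apply/allP=> i _.
Qed.

Lemma mulg_tpermK (T : finType) (x y : T) (s : {perm T}) :
  (s * tperm x y * tperm x y)%g = s.
Proof. by rewrite -mulgA tperm2 mulg1. Qed.

(** * The three tableaux and their stabilizers *)

Section HookCoefficients.
Variables (n m : nat) (n_gt0 : (0 < n)%N).
Implicit Types (r s t : 'S_(n + m)) (a : 'I_n) (b i : 'I_m).

Let Sn : {group 'S_(n + m)} := [group of Sym (int_1n n m)].
Let Sm : {group 'S_(n + m)} := [group of Sym (int_n1nm n m)].
Let pt := pt1 m n_gt0.
Let SX : {group 'S_(n + m)} := [group of Sym (pt |: int_n1nm n m)].

Lemma lshift_in a : lshift m a \in int_1n n m.
Proof. by rewrite inE /=. Qed.

Lemma rshift_in b : rshift n b \in int_n1nm n m.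
Proof. by rewrite inE /= leq_addr. Qed.

Lemma int_n1nmC x : (x \in int_n1nm n m) = (x \notin int_1n n m).
Proof. by rewrite !inE -leqNgt. Qed.

Lemma rshift_notin b : rshift n b \notin int_1n n m.
Proof. by rewrite -int_n1nmC rshift_in. Qed.

Lemma int_1nP x : x \in int_1n n m -> exists a, x = lshift m a.
Proof. by rewrite inE => lt_xn; exists (Ordinal lt_xn); apply: val_inj. Qed.

Lemma int_n1nmP x : x \in int_n1nm n m -> exists b, x = rshift n b.
Proof.
case: (split_ordP x) => [a ->|b -> _]; last by exists b.
by rewrite int_n1nmC lshift_in.
Qed.

Lemma set_lshift : [set x in [seq lshift m a | a <- enum 'I_n]] = int_1n n m.
Proof.
apply/setP=> x; rewrite in_set; apply/mapP/idP => [[a _ ->]|/int_1nP[a ->]].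
  exact: lshift_in.
by exists a; rewrite ?mem_enum.
Qed.

Lemma set_rshift : [set x in [seq rshift n b | b <- enum 'I_m]] = int_n1nm n m.
Proof.
apply/setP=> x; rewrite in_set; apply/mapP/idP => [[b _ ->]|/int_n1nmP[b ->]].
  exact: rshift_in.
by exists b; rewrite ?mem_enum.
Qed.

Lemma row_stab_left : row_stab (tab_left n m) = [set 1%g].
Proof.
rewrite /row_stab (@block_stab_singletons _ [::]) //; first last.
  by move=> c /mapP[/= r /mapP[a _ ->] ->]; right; exists (lshift m a).
by rewrite -Sym0; congr (Sym _); apply/setP=> x; rewrite !inE.
Qed.

Lemma col_stab_left : col_stab (tab_left n m) = Sn.
Proof.
have tab_colsE :
    tab_cols (tab_left n m) = [:: [seq lshift m a | a <- enum 'I_n]].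
  have [e ee _] := enum_ord_head n_gt0.
  rewrite /tab_cols /tab_left /tab_map /tab_col ee /=.
  by congr [:: _ :: _]; elim: e {ee} => //= a e ->.
rewrite /col_stab tab_colsE.
rewrite (@block_stab_singletons _ [seq lshift m a | a <- enum 'I_n]).
- by rewrite set_lshift.
- by rewrite /= cats0.
- by move=> c; rewrite inE => /eqP; left.
Qed.

Lemma row_stab_right : row_stab (tab_right n m) = Sm.
Proof.
rewrite /row_stab.
rewrite (@block_stab_singletons _ [seq rshift n b | b <- enum 'I_m]).
- by rewrite set_rshift.
- by rewrite /= cats0.
- by move=> c; rewrite inE => /eqP; left.
Qed.

Lemma col_stab_right : col_stab (tab_right n m) = [set 1%g].
Proof.
rewrite /col_stab (@block_stab_singletons _ [::]) //; first last.
  move=> c /mapP[j]; rewrite mem_iota /= => lt_jm ->; right.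
  have: onth [seq rshift n b | b <- enum 'I_m] j by rewrite onthTE.
  by case: onth => // x _; exists x.
by rewrite -Sym0; congr (Sym _); apply/setP=> x; rewrite !inE.
Qed.

Lemma tab_hookE : exists2 e : seq 'I_n,
    enum 'I_n = Ordinal n_gt0 :: e &
    tab_hook n m = (pt :: [seq rshift n b | b <- enum 'I_m])
                     :: [seq [:: lshift m a] | a <- e].
Proof.
have [e ee e_neq0] := enum_ord_head n_gt0; exists e => //.
rewrite /tab_hook ee /=; congr cons.
by apply/eq_in_map => a /(allP e_neq0)/negPf->.
Qed.

Lemma row_stab_hook : row_stab (tab_hook n m) = SX.
Proof.
have [e ee tE] := tab_hookE.
rewrite /row_stab tE.
rewrite (@block_stab_singletons _ (pt :: [seq rshift n b | b <- enum 'I_m])).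
- by congr (Sym _); rewrite set_cons set_rshift.
- by move=> x xb; rewrite /= -cat_cons mem_cat xb.
move=> c; rewrite inE => /predU1P[|/mapP[a ae ->]]; first by left.
right; exists (lshift m a) => //; rewrite inE negb_or; apply/andP; split.
  have : uniq (enum 'I_n) by apply: enum_uniq.
  rewrite ee /= => /andP[+ _]; apply: contraNneq => /lshift_inj <- //.
by apply/mapP=> -[b _ /eqP]; rewrite eq_lrshift.
Qed.

Lemma col_stab_hook : col_stab (tab_hook n m) = Sn.
Proof.
have [e ee tE] := tab_hookE; rewrite /col_stab.
(* Column 0 meets every row; column [j.+1] meets only the top row, the others having length 1, and
   so is a singleton. *)
have tab_colsE : tab_cols (tab_hook n m) = [seq lshift m a | a <- enum 'I_n]
    :: [seq pmap (fun w => onth w j.+1) (tab_hook n m) | j <- iota 0 m].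
  rewrite /tab_cols tE /= size_map size_enum_ord; congr cons.
    by rewrite ee /=; congr cons; elim: (e) => //= a e' ->.
  by rewrite (iotaDl 1 0) -map_comp.
rewrite tab_colsE.
rewrite (@block_stab_singletons _ [seq lshift m a | a <- enum 'I_n]).
- by rewrite set_lshift.
- by move=> x xb; rewrite /= mem_cat xb.
move=> c; rewrite inE => /predU1P[|/mapP[j]]; first by left.
rewrite mem_iota tE /= => lt_jm ->; right.
have -> : pmap (fun w => onth w j.+1) [seq [:: lshift m a] | a <- e] = [::].
  by elim: (e) => //= a e' ->; rewrite onth0n.
rewrite onth_map.
have: onth (enum 'I_m) j by rewrite onthTE size_enum_ord.
case: onth => // b _; exists (rshift n b) => //.
by apply/mapP=> -[a _ /eqP]; rewrite eq_rlshift.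
Qed.

Lemma young_prodE :
  young (tab_left n m) * young (tab_right n m) * young (tab_hook n m)
    = (zaltsum Sn * zsum SX * zaltsum Sn) *~ (m`!)%:Z.
Proof.
rewrite /young row_stab_left col_stab_left row_stab_right col_stab_right.
rewrite row_stab_hook col_stab_hook zsum1 zaltsum1 mul1r mulr1.
rewrite mulrA -[_ * zsum Sm * zsum SX]mulrA zsum_sub_mul.
  rewrite mulrzAr mulrzAl; congr (_ *~ _).
  rewrite /= card_Sym -[in RHS](card_ord m).
  rewrite -(card_imset 'I_m (@rshift_inj n m)).
  congr (_`!%:Z); apply: eq_card => x.
  apply/idP/imsetP => [/int_n1nmP[b ->]|[b _ ->]].
    by exists b.
  exact: rshift_in.
apply/subsetP=> s; rewrite !inE => /subset_trans; apply; exact: subsetUr.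
Qed.


(** * Counting factorizations by the elements of S_n that match rho off one point *)

Definition agree_off a r s :=
  [forall x : 'I_n, (x != a) ==> (r (lshift m x) == s (lshift m x))].

Lemma agree_offP a r s :
  reflect (forall x, x != a -> r (lshift m x) = s (lshift m x))
          (agree_off a r s).
Proof.
apply: (iffP forallP) => rs x; first by move/(implyP (rs x))/eqP.
by apply/implyP=> /rs->.
Qed.

Lemma Sn_closed s x : s \in Sn -> (s x \in int_1n n m) = (x \in int_1n n m).
Proof. by rewrite inE => /perm_closed->. Qed.

Lemma Sn_lshift s a : s \in Sn -> exists a', s (lshift m a) = lshift m a'.
Proof. by move=> sSn; apply: int_1nP; rewrite Sn_closed ?lshift_in. Qed.

Lemma Sn_rshift s b : s \in Sn -> s (rshift n b) = rshift n b.
Proof. by rewrite inE => /out_perm->; rewrite ?rshift_notin. Qed.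

Lemma SmP s : reflect (forall a, s (lshift m a) = lshift m a) (s \in Sm).
Proof.
rewrite inE; apply: (iffP idP) => [s_on a|s_fix].
  by rewrite (out_perm s_on) // int_n1nmC lshift_in.
apply/subsetP=> x; rewrite int_n1nmC inE; apply: contraNN => /int_1nP[a ->].
by rewrite s_fix.
Qed.

Lemma pt_in : pt \in int_1n n m.
Proof. exact: lshift_in. Qed.

Lemma int_2nE : int_2n n m = int_1n n m :\ pt.
Proof. by apply/setP=> x; rewrite !inE -val_eqE /= lt0n. Qed.

Lemma Sym_int_2nE s : (s \in Sym (int_2n n m)) = (s \in Sn) && (s pt == pt).
Proof.
rewrite int_2nE inE [s \in _]inE; apply/idP/andP => [s_on|[s_on /eqP s_pt]].
  split; first by apply: subset_trans s_on _; apply: subsetDl.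
  by apply/eqP; rewrite (out_perm s_on) // setD11.
apply/subsetP=> x sx; rewrite in_setD1 (subsetP s_on) // andbT.
by apply: contraNneq sx => ->; rewrite s_pt.
Qed.

Lemma tperm_Sn x y : x \in int_1n n m -> y \in int_1n n m -> tperm x y \in Sn.
Proof.
move=> xn yn; rewrite inE; apply: subset_trans (tperm_on x y) _.
by apply/subsetP=> z; rewrite in_set2 => /orP[]/eqP->.
Qed.

Lemma alpha_Sn a : alpha m n_gt0 a \in Sn.
Proof. by apply: tperm_Sn; apply: lshift_in. Qed.

(** Applying [alpha a] first sends [lshift m a] to [pt], so the fiber is a translate of S_[2,n], the
    stabilizer of [pt] in [Sn]. *)
Lemma card_Sn_fiber a :
  #|[set s in Sn | s (lshift m a) == pt]| = (n.-1)`!.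
Proof.
have <- : #|int_2n n m| = n.-1.
  have := cardsD1 pt (int_1n n m); rewrite pt_in -int_2nE.
  rewrite -set_lshift cardsE.
  have /card_uniqP-> : uniq [seq lshift m a | a <- enum 'I_n].
    by rewrite map_inj_uniq ?enum_uniq //; apply: lshift_inj.
  by rewrite size_map size_enum_ord => /(congr1 predn)->.
rewrite -card_Sym.
rewrite -(card_imset (mem (Sym (int_2n n m))) (mulgI (alpha m n_gt0 a))).
apply: eq_card => s; rewrite inE; apply/andP/imsetP => [[sSn s_a]|[h + ->]].
  exists ((alpha m n_gt0 a)^-1 * s)%g; last by rewrite mulKVg.
  by rewrite Sym_int_2nE groupMl ?groupV ?alpha_Sn // sSn tpermV permM tpermL.
rewrite Sym_int_2nE => /andP[hSn /eqP h_pt].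
by rewrite groupMl ?alpha_Sn // hSn permM tpermR h_pt.
Qed.

(** The permutation [r * t^-1] fixes [x] exactly when [r x = t x], and conjugation by [s] carries
    its fixed points along [s]. Lying in [SX] means fixing [1,n] minus [pt], whose preimage under
    [s] is [1,n] minus [a]. *)
Lemma conj_SX a r s t : s \in Sn -> s (lshift m a) = pt ->
  (((r * t^-1) ^ s)%g \in SX) = agree_off a r t.
Proof.
move=> sSn s_a; rewrite inE; apply/subsetP/agree_offP => [r_on x x_a|rt x].
  apply: (canRL (permKV t)).
  apply/eqP; have /contra : _ -> s (lshift m x) \in _ := r_on _.
  rewrite [X in _ -> ~~ X]inE permJ (inj_eq perm_inj) permM negbK; apply.
  rewrite in_setU1 int_n1nmC Sn_closed // lshift_in orbF.
  by rewrite -s_a (inj_eq perm_inj) (inj_eq (@lshift_inj _ _)).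
rewrite in_setU1 int_n1nmC inE; apply: contraNT.
rewrite negb_or negbK => /andP[x_pt].
rewrite -(permKV s x) Sn_closed // => /int_1nP[y ey].
rewrite ey permJ permM rt ?permK // -(inj_eq (@lshift_inj n m)) -ey.
by rewrite -(inj_eq (@perm_inj _ s)) permKV s_a.
Qed.

(** By [agree_off_inj] at most one term is nonzero, so the value is a sign, or 0 when there is no
    match. *)
Definition signed_matches a r : int :=
  \sum_(t in Sn) psgn t * (agree_off a r t)%:R.

(* Substituting [s^-1 * r] and [s^-1 * t] for the summation variables turns the
   condition on the factor in S_X into [(r * t^-1) ^ s \in SX], which depends
   on [s] only through [s^-1 pt]. *)
Lemma zcoef_altsum_sum_altsum r :
  zcoef (zaltsum Sn * zsum SX * zaltsum Sn) r
    = (n.-1)`!%:Z * \sum_a signed_matches a r.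
Proof.
have r_inj : injective (fun s => s^-1 * r)%g by move=> s t /mulIg/invg_inj.
rewrite zcoefM (reindex_inj r_inj) /=.
transitivity (\sum_(s in Sn) \sum_(t in Sn)
    psgn t * ((r * t^-1) ^ s \in SX)%:R%g).
  rewrite [RHS]big_mkcond; apply: eq_bigr => s _.
  rewrite invMg invgK mulKVg zcoef_zaltsum.
  case: ifP => sSn; last by rewrite mul0r mulr0.
  rewrite zcoefM (reindex_inj (mulgI s^-1%g)) /= mul1r mulr_suml.
  rewrite [RHS]big_mkcond.
  apply: eq_bigr => t _; rewrite zcoef_zaltsum zcoef_zsum groupMl ?groupV //.
  case: ifP => _; rewrite ?mul0r // mul1r.
  (* The signs of [s^-1 * t] and [s] multiply to that of [t]. *)
  rewrite invMg invgK conjgE !mulgA mulrAC -psgnM.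
  by rewrite /psgn !odd_permM odd_permV addbAC addbb addFb.
(* Only the [a] that [s] sends to [pt] survives. Inserting the sum over [a] lets the sums be
   exchanged, after which the sum over [s] counts a fiber of size (n-1)!. *)
transitivity (\sum_(s in Sn) \sum_a
    (s (lshift m a) == pt)%:R * signed_matches a r).
  apply: eq_bigr => s sSn.
  have [a sa] : exists a, s (lshift m a) = pt.
    have [a ea] : exists a, (s^-1)%g pt = lshift m a.
      by apply: Sn_lshift; rewrite groupV.
    by exists a; rewrite -ea permKV.
  rewrite [RHS](bigD1 a) //= sa eqxx mul1r [X in _ + X]big1 ?addr0.
    by apply: eq_bigr => t _; rewrite (conj_SX _ _ sSn sa).
  move=> x x_a; rewrite -sa (inj_eq perm_inj) (inj_eq (@lshift_inj _ _)).
  by rewrite (negPf x_a) mul0r.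
rewrite exchange_big mulr_sumr; apply: eq_bigr => a _.
rewrite -mulr_suml; congr (_ * _).
by rewrite -(card_Sn_fiber a) -natr_sum -sum1dep_card natz big_mkcondr.
Qed.

(** The quotient [s * t^-1] fixes every point other than [lshift m a], and a permutation moving at
    most one point is the identity. *)
Lemma agree_off_inj a r s t :
  s \in Sn -> t \in Sn -> agree_off a r s -> agree_off a r t -> s = t.
Proof.
move=> sSn tSn /agree_offP rs /agree_offP rt; apply/eqP; rewrite eq_mulgV1.
apply/eqP/(perm_on_id (S := [set lshift m a])); last by rewrite cards1.
apply/subsetP=> x; rewrite !inE permM; apply: contraNT => x_a.
apply/eqP/(canLR (permK t)); case: (split_ordP x) x_a => [y -> | b -> _].
  by rewrite (inj_eq (@lshift_inj _ _)) => y_a; rewrite -rt ?rs.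
by rewrite !Sn_rshift.
Qed.

Lemma signed_matches_agree a r s :
  s \in Sn -> agree_off a r s -> signed_matches a r = psgn s.
Proof.
move=> sSn rs; rewrite /signed_matches (bigD1 s) //= rs mulr1 big1 ?addr0 //.
move=> t /andP[tSn t_s].
case: (boolP (agree_off a r t)) => [rt|]; last by rewrite mulr0.
by rewrite (agree_off_inj tSn sSn rt rs) eqxx in t_s.
Qed.

(** * Matches of rho in S_n S_m *)

Lemma pshift_lshift (u : 'S_m) a : pshift n u (lshift m a) = lshift m a.
Proof. by rewrite permE /pshift_fun (unsplitK (inl a)). Qed.

Lemma pshift_rshift (u : 'S_m) b : pshift n u (rshift n b) = rshift n (u b).
Proof. by rewrite permE /pshift_fun (unsplitK (inr b)). Qed.

Lemma Sm_pshift t : t \in Sm -> exists u : 'S_m, t = pshift n u.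
Proof.
(* The default [b] is never taken: [t] fixes [1,n] pointwise, so by injectivity it sends no point of
   [n+1,n+m] there. *)
move=> tSm; pose f b := if split (t (rshift n b)) is inr b' then b' else b.
have fE b : t (rshift n b) = rshift n (f b).
  rewrite /f; case: split_ordP => // a /eqP.
  by rewrite -[lshift m a](SmP _ tSm) (inj_eq perm_inj) eq_rlshift.
have f_inj : injective f.
  move=> b b' /(congr1 (@rshift n m)); rewrite -!fE.
  by move=> /perm_inj/rshift_inj.
exists (perm f_inj); apply/permP=> x; case: (split_ordP x) => [a ->|b ->].
  by rewrite pshift_lshift (SmP _ tSm).
by rewrite pshift_rshift permE fE.
Qed.

Lemma SnSm_lshift r a : r \in SnSm n m -> r (lshift m a) \in int_1n n m.
Proof.
case/imset2P=> s t sSn /SmP tSm ->.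
by rewrite pcompE tSm Sn_closed // lshift_in.
Qed.

(** Since tau^{+n} fixes [1,n], rho agrees there with sigma_rho, which is therefore the match for
    every [a]. *)
Lemma signed_matches_SnSm a r :
  r \in SnSm n m -> signed_matches a r = psgn (sigma_of r).
Proof.
move=> rS; rewrite /sigma_of.
case: pickP => [s /andP[sSn /existsP[t /eqP ->]]|] /=.
  apply: signed_matches_agree => //.
  by apply/agree_offP=> x _; rewrite pcompE pshift_lshift.
case/imset2P: rS => s t sSn /Sm_pshift[u ->] -> /(_ s) /=; rewrite sSn /=.
by move/existsP; case; exists u.
Qed.

(** * Matches of rho in C_{a,b}, and the case distinction *)

Lemma CsetP a b r : reflect
  ((forall x, x != a -> r (lshift m x) \in int_1n n m)
   /\ r (lshift m a) = rshift n b)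
  (r \in Cset a b).
Proof.
rewrite inE; apply: (iffP andP) => [[/forallP rn /eqP ra]|[rn ra]]; split=> //.
- by move=> x /(implyP (rn x)); rewrite inE.
- by apply/forallP=> x; apply/implyP=> /rn; rewrite inE.
- exact/eqP.
Qed.

(** Otherwise [1,n] would lie in its image under [r], hence equal it by cardinality; but that image
    contains n+b. *)
Lemma missP a b r : r \in Cset a b ->
  lshift m (miss a r) \notin r @: int_1n n m.
Proof.
case/CsetP=> _ ra; rewrite /miss; case: pickP => //= n_sub.
have : r (lshift m a) \in r @: int_1n n m by apply/imset_f/lshift_in.
suff <- : int_1n n m = r @: int_1n n m by rewrite ra (negPf (rshift_notin b)).
apply/eqP; rewrite eqEcard card_imset ?leqnn ?andbT; last exact: perm_inj.
by apply/subsetP=> x /int_1nP[y ->]; apply/negbFE/n_sub.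
Qed.

(** Change the value of [r] at [a] to the missing value a' and take the identity above n; the result
    is injective because a' is not a value of [r] on [1,n]. *)
Lemma Cset_agree a b r : r \in Cset a b ->
  exists s, [/\ s \in Sn, agree_off a r s
              & s (lshift m a) = lshift m (miss a r)].
Proof.
move=> rC; have miss_r := missP rC; have [rn ra] := CsetP _ _ _ rC.
pose f x := if x \in int_1n n m then
  if x == lshift m a then lshift m (miss a r) else r x else x.
have f_in x : (f x \in int_1n n m) = (x \in int_1n n m).
  rewrite /f; case: ifPn => [/int_1nP[y ->]|/negPf //].
  case: eqP => [_|/eqP]; first by rewrite lshift_in.
  by rewrite (inj_eq (@lshift_inj _ _)) => /rn.
have f_inj : injective f.
  move=> x y exy; have xy_in : (x \in int_1n n m) = (y \in int_1n n m).
    by rewrite -f_in exy f_in.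
  move: exy; rewrite /f xy_in; case: ifP => // yn.
  case: eqP => [->|_]; case: eqP => [-> //|_]; last exact: perm_inj.
    by move=> e; rewrite e imset_f in miss_r.
  by move=> e; rewrite -e imset_f ?xy_in in miss_r.
exists (perm f_inj); split.
- rewrite inE; apply/subsetP=> x; rewrite inE permE; apply: contraNT => xn.
  by rewrite /f (negPf xn).
- apply/agree_offP=> x x_a; rewrite permE /f lshift_in.
  by rewrite (inj_eq (@lshift_inj _ _)) (negPf x_a).
- by rewrite permE /f lshift_in eqxx.
Qed.

(** With [s] the match of rho, h = alpha_{a'} s alpha_a fixes 1 through 1 -> a -> a' -> 1, and it
    does not involve [i]. *)
Lemma h_exists a b r : r \in Cset a b ->
  exists2 h, h \in Sym (int_2n n m) & forall i, exists u : 'S_m,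
    r = alpha m n_gt0 (miss a r) \oP beta n i b \oP gamma n_gt0 i
             \oP pshift n u \oP h \oP alpha m n_gt0 a.
Proof.
move=> rC; have [rn ra] := CsetP _ _ _ rC.
have [s [sSn /agree_offP rs sa]] := Cset_agree rC.
pose al := alpha m n_gt0; set a' := miss a r in sa *.
exists (al a * s * al a')%g.
  rewrite Sym_int_2nE !groupM ?alpha_Sn //=.
  by rewrite !permM tpermL sa tpermR.
(* The desired factorization solved for tau^{+n}. It fixes 1 through 1 -> a' -> a -> n+b -> n+i ->
   1; at the other points of [1,n], [r] and [s^-1] cancel. *)
move=> i; pose p := (al a' * s^-1 * r * al a' * beta n i b * gamma n_gt0 i)%g.
have /Sm_pshift[u ep] : p \in Sm.
  apply/SmP=> y; rewrite !permM; have [->|y_pt] := eqVneq (lshift m y) pt.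
    rewrite tpermL -sa permK ra [al a' _]tpermD ?eq_lrshift //.
    by rewrite tpermR tpermR.
  have [z ez] := Sn_lshift y (alpha_Sn a').
  have [x ex] : exists x, (s^-1)%g (lshift m z) = lshift m x.
    by apply: Sn_lshift; rewrite groupV.
  rewrite ez ex rs; last first.
    apply: contraNneq y_pt => exa.
    rewrite -(inj_eq (@perm_inj _ (al a'))) ez tpermL.
    by rewrite -sa -exa -ex permKV.
  rewrite -ex permKV -ez tpermK [beta _ _ _ _]tpermD ?eq_rlshift //.
  by rewrite [gamma _ _ _]tpermD ?eq_rlshift // eq_sym.
exists u; rewrite -ep /p /al /alpha /beta /gamma /Defs.pcomp !mulgA.
by rewrite tperm2 mul1g !mulg_tpermK mulgV mul1g.
Qed.

(** For x other than a, h alpha_a sends x into [2,n], where tau^{+n}, gamma_i and beta_b act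
    trivially. Hence alpha_{a'} h alpha_a matches rho off a, and its sign is [sgnC]. *)
Lemma signed_matches_Cset a b r :
  r \in Cset a b -> signed_matches a r = sgnC n_gt0 a b r.
Proof.
move=> rC; rewrite /sgnC /h_of; case: pickP => [h|] /=; last first.
  have [h hS hP] := h_exists rC; move/(_ h); rewrite hS => /negbT/forallPn[i].
  by have [u eu] := hP i => /existsPn/(_ u)/eqP.
set al := alpha m n_gt0; rewrite Sym_int_2nE => /andP[/andP[hSn /eqP h_pt]].
(* The same [h] serves every index [i]; [b] is an element of ['I_m] at hand. *)
move/forallP/(_ b)/existsP=> [u /eqP er].
rewrite (@signed_matches_agree a r (al a * h * al (miss a r))%g).
- by rewrite !psgnM mulrC mulrAC mulrA mulrAC.
- by rewrite !groupM ?alpha_Sn.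
apply/agree_offP=> x x_a; rewrite {1}er !pcompE.
have [y ey] := Sn_lshift x (alpha_Sn a).
have [z ez] := Sn_lshift y hSn.
rewrite ey ez pshift_lshift.
have z_pt : pt != lshift m z.
  rewrite -ez -h_pt (inj_eq perm_inj) -ey; apply: contraNneq x_a.
  by move/(congr1 (al a)); rewrite tpermK tpermL => /lshift_inj->.
by rewrite [gamma _ _ _]tpermD ?eq_rlshift // [beta _ _ _ _]tpermD ?eq_rlshift.
Qed.

(** The cases are whether [r] sends [a] into [1,n] or above n. In the first, [r * s^-1] maps [a]
    into [1,n] and fixes the rest of [1,n], hence fixes [a] too and lies in [Sm]. *)
Lemma agree_cases a r s : s \in Sn -> agree_off a r s ->
  r \in SnSm n m \/ exists b, r \in Cset a b.
Proof.
move=> sSn /agree_offP rs.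
have rn x : x != a -> r (lshift m x) \in int_1n n m.
  by move=> x_a; rewrite rs // Sn_closed // lshift_in.
case: (split_ordP (r (lshift m a))) => [y ra|b ra]; last first.
  by right; exists b; apply/CsetP.
left; apply/imset2P; exists s (r * s^-1)%g => //; last first.
  by rewrite /Defs.pcomp mulgKV.
have r_fix x : x != a -> (r * s^-1)%g (lshift m x) = lshift m x.
  by move=> x_a; rewrite permM rs ?permK.
apply/SmP=> x; have [->|] := eqVneq x a; last exact: r_fix.
have [z ez] : exists z, (r * s^-1)%g (lshift m a) = lshift m z.
  by rewrite permM ra; apply: Sn_lshift; rewrite groupV.
rewrite ez; congr lshift; apply/eqP; apply: contraT => z_a; have := r_fix z z_a.
by rewrite -[RHS]ez => /perm_inj/lshift_inj e; rewrite e eqxx in z_a.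
Qed.

(** For fixed [a] the cases exclude each other: rho(a) = n+b determines b and rules out S_n S_m,
    whose elements preserve [1,n]. Outside them [agree_cases] leaves no match. *)
Lemma signed_matchesE a r :
  signed_matches a r = (if r \in SnSm n m then psgn (sigma_of r) else 0)
    + \sum_b (if r \in Cset a b then sgnC n_gt0 a b r else 0).
Proof.
have [/existsP[b rC]|/existsPn rC] := boolP [exists b, r \in Cset a b].
  have [_ ra] := CsetP _ _ _ rC.
  rewrite ifN; last first.
    by apply/negP=> /(SnSm_lshift a); rewrite ra (negPf (rshift_notin b)).
  rewrite add0r (bigD1 b) //= rC big1 ?addr0; first exact: signed_matches_Cset.
  move=> b' b'_b; case: ifP => // /CsetP[_]; rewrite ra => /rshift_inj e.
  by rewrite e eqxx in b'_b.
rewrite [X in _ + X]big1 ?addr0; last by move=> b _; rewrite (negPf (rC b)).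
case: ifP => [/signed_matches_SnSm-> //|rS].
apply: big1 => s sSn.
case: (boolP (agree_off a r s)) => rs; last by rewrite mulr0.
case: (agree_cases sSn rs) => [|[b]]; first by rewrite rS.
by rewrite (negPf (rC b)).
Qed.

(** * Coefficients of the whole product and their gcd *)

Lemma zcoef_young_prod r :
  zcoef (young (tab_left n m) * young (tab_right n m) * young (tab_hook n m)) r
    = (m`! * (n.-1)`!)%N%:Z * \sum_a signed_matches a r.
Proof. by rewrite young_prodE zcoefMz zcoef_altsum_sum_altsum mulrA PoszM. Qed.

(** Only a = 1 has a match, the identity; for other a, the point 1 must be matched but goes outside
    [1,n]. Summing over a gives gamma_i the coefficient m!(n-1)!, which bounds the gcd. *)
Lemma signed_matches_gamma a i :
  signed_matches a (gamma n_gt0 i) = (a == Ordinal n_gt0)%:R.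
Proof.
case: eqP => [->|/eqP a_0].
  rewrite (signed_matches_agree (group1 Sn)) ?psgn1 //.
  apply/agree_offP=> x x_0; rewrite perm1 tpermD ?eq_rlshift //.
  by rewrite (inj_eq (@lshift_inj _ _)) eq_sym.
apply: big1 => s sSn; case: (boolP (agree_off a _ s)); last by rewrite mulr0.
move/agree_offP/(_ (Ordinal n_gt0)); rewrite eq_sym => /(_ a_0).
have [y ->] := Sn_lshift (Ordinal n_gt0) sSn.
by rewrite tpermL => /eqP; rewrite eq_rlshift.
Qed.

End HookCoefficients.

Theorem proposition4p1 (n m : nat) (n_gt0 : (0 < n)%N) (m_gt0 : (0 < m)%N) :
  young (tab_left n m) * young (tab_right n m) * young (tab_hook n m)
  = \sum_(rho in SnSm n m)
      zdelta rho *~ ((m`!)%:Z * (n`!)%:Z * psgn (sigma_of rho))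
    + \sum_(a < n) \sum_(b < m) \sum_(rho in Cset a b)
        zdelta rho *~ ((m`!)%:Z * ((n.-1)`!)%:Z * sgnC n_gt0 a b rho)
  /\ theta n m = (m`! * (n.-1)`!)%N.
Proof.
split.
  apply: zpermP => r; rewrite (zcoef_young_prod n_gt0) zcoefD zcoef_combination.
  under eq_bigr => a _ do rewrite (signed_matchesE n_gt0).
  rewrite big_split mulrDr /=; congr (_ + _).
    (* All n indices [a] contribute the same sign, and n (n-1)! = n!. *)
    rewrite sumr_const card_ord; case: ifP => _; last by rewrite mul0rn mulr0.
    rewrite -mulr_natl natz mulrA -!PoszM -mulnA -[in (_ * n)%N](prednK n_gt0).
    by rewrite [((n.-1)`! * _)%N]mulnC -factS prednK.
  rewrite zcoef_sum mulr_sumr; apply: eq_bigr => a _.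
  rewrite zcoef_sum mulr_sumr; apply: eq_bigr => b _.
  by rewrite zcoef_combination PoszM; case: ifP; rewrite ?mulr0.
apply/eqP; rewrite /theta /young_prod eqn_dvd; apply/andP; split.
  (* The coefficient of this transposition is m!(n-1)! itself, so the gcd divides that number. *)
  apply: (biggcdn_inf (gamma n_gt0 (Ordinal m_gt0))) => //.
  rewrite (zcoef_young_prod n_gt0).
  under eq_bigr => a _ do rewrite signed_matches_gamma.
  rewrite (bigD1 (Ordinal n_gt0)) //= ?eqxx big1 ?addr0 ?mulr1 //.
  by move=> a /negPf->.
by apply/dvdn_biggcdP=> r _; rewrite (zcoef_young_prod n_gt0) abszM dvdn_mulr.
Qed.
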